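(* (1) Let $\mathbf E=(E,+,{}',0,1)$ be a lattice effect algebra, let $\mathbb{IL}(\mathbf E)=(E,\rightarrow,0)$ with $x\rightarrow y:=y+(x\vee y)'$, and let $\mathbb{EL}(\mathbb{IL}(\mathbf E))=(E,\oplus,{}^*,0,e)$ be obtained from it by $x^*:=x\rightarrow0$, $e:=0^*$, and $x\oplus y$ defined iff $x\rightarrow y^*=1$, in which case $x\oplus y:=x^*\rightarrow y$. Then $\mathbb{EL}(\mathbb{IL}(\mathbf E))=\mathbf E$, i.e. $\oplus$ is defined exactly when $+$ is and coincides with it, $x^*=x'$ for all $x$, and $e=1$. (2) Let $\mathbf I=(I,\rightarrow,0)$ be a lattice effect implication algebra, let $\mathbb{EL}(\mathbf I)=(I,+,{}',0,1)$ with $x':=x\rightarrow0$, $1:=0'$, and $x+y$ defined iff $x\rightarrow y'=1$, in which case $x+y:=x'\rightarrow y$, and let $\mathbb{IL}(\mathbb{EL}(\mathbf I))=(I,\Rightarrow,0)$ with $x\Rightarrow y:=y+(x\vee y)'$, where $\vee$ is the join in the induced order of $\mathbb{EL}(\mathbf I)$. Then $\mathbb{IL}(\mathbb{EL}(\mathbf I))=\mathbf I$, i.e. $x\Rightarrow y=x\rightarrow y$ for all $x,y\in I$.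
   Context: An effect algebra is a structure $(E,+,{}',0,1)$ where $E$ is a set, ${}'$ is a unary operation on $E$, $0,1\in E$, and $+$ is a partial binary operation on $E$ such that for all $x,y,z\in E$: (E1) if $x+y$ is defined then so is $y+x$ and $x+y=y+x$; (E2) $(x+y)+z$ is defined if and only if $x+(y+z)$ is defined, and then they are equal; (E3) $x+y$ is defined and equals $1$ if and only if $y=x'$; (E4) if $1+x$ is defined then $x=0$. The induced order is $x\leq y$ iff there exists $z$ with $x+z=y$. A lattice effect algebra is an effect algebra whose induced order is a lattice order, with join $\vee$. A lattice effect implication algebra is an algebra $(I,\rightarrow,0)$ with a binary operation $\rightarrow$ and a constant $0$ such that, writing $x':=x\rightarrow0$ and $1:=0'$, for all $x,y,z\in I$: (i) $0\rightarrow x=x\rightarrow x=x\rightarrow1=1$; (ii) if $x\rightarrow y=y\rightarrow x=1$ then $x=y$; (iii) if $x\rightarrow y=y\rightarrow z=1$ then $x\rightarrow z=1$; (iv) if $x\rightarrow y=1$ then $y'\rightarrow x'=1$; (v) $x''=x$; (vi) $x\rightarrow((x\rightarrow y)\rightarrow y)=1$; (vii) $y\rightarrow((x\rightarrow y)\rightarrow y)=1$; (viii) if $x\rightarrow z=y\rightarrow z=1$ then $((x\rightarrow y)\rightarrow y)\rightarrow z=1$; (ix) if $x\rightarrow y=1$ then $y\rightarrow x=x'\rightarrow y'$; (x) [$x\rightarrow y'=1$ and $(x'\rightarrow y)\rightarrow z'=1$] if and only if [$y\rightarrow z'=1$ and $x\rightarrow(y'\rightarrow z)'=1$], and in this case $(x'\rightarrow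 y)'\rightarrow z=x'\rightarrow(y'\rightarrow z)$; (xi) $y'\rightarrow((x\rightarrow y)\rightarrow y)'=x\rightarrow y$; (xii) $x\rightarrow(y\rightarrow x)=1$. It is known that $\mathbb{IL}(\mathbf E)$ is a lattice effect implication algebra for every lattice effect algebra $\mathbf E$ and $\mathbb{EL}(\mathbf I)$ is a lattice effect algebra for every lattice effect implication algebra $\mathbf I$. *)

(* Defs.v *)
From Stdlib Require Import Relation_Definitions ClassicalEpsilon.

Set Implicit Arguments.
Unset Strict Implicit.

(* A partial binary operation on E is a function E -> E -> option E, with None
   for "undefined"; equality of two such functions therefore means that they
   have the same domain of definition and the same values on it. *)
Record effect_ops (E : Type) : Type := EffectOps {
  plus : E -> E -> option E;
  compl : E -> E;
  ezero : E;
  eone : E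
}.

Record is_effect_algebra (E : Type) (A : effect_ops E) : Prop := {
  effect_E1 : forall x y s, plus A x y = Some s -> plus A y x = Some s;
  effect_E2 : forall x y z s,
    (exists u, plus A x y = Some u /\ plus A u z = Some s) <->
    (exists v, plus A y z = Some v /\ plus A x v = Some s);
  effect_E3 : forall x y, plus A x y = Some (eone A) <-> y = compl A x;
  effect_E4 : forall x s, plus A (eone A) x = Some s -> x = ezero A
}.

Definition induced_le (E : Type) (A : effect_ops E) : relation E :=
  fun x y => exists z, plus A x z = Some y.

Definition is_join (T : Type) (le : relation T) (x y j : T) : Prop :=
  le x j /\ le y j /\ forall z, le x z -> le y z -> le j z.

Definition is_meet (T : Type) (le : relation T) (x y m : T) : Prop :=
  le m x /\ le m y /\ forall z, le z x -> le z y -> le z m.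

Record is_lattice_order (T : Type) (le : relation T) : Prop := {
  lattice_order_order : order T le;
  lattice_order_join : forall x y, exists j, is_join le x y j;
  lattice_order_meet : forall x y, exists m, is_meet le x y m
}.

Record is_lattice_effect_algebra (E : Type) (A : effect_ops E) : Prop := {
  lattice_effect_effect : is_effect_algebra A;
  lattice_effect_lattice : is_lattice_order (induced_le A)
}.

(* The join in the induced order is selected by Hilbert's epsilon; it is the
   least upper bound whenever the latter exists. *)
Definition join (E : Type) (A : effect_ops E) (x y : E) : E :=
  epsilon (inhabits (ezero A)) (is_join (induced_le A) x y).

Record imp_ops (I : Type) : Type := ImpOps {
  imp : I -> I -> I;
  izero : I
}.

Definition neg (I : Type) (B : imp_ops I) (x : I) : I := imp B x (izero B).

Definition ione (I : Type) (B : imp_ops I) : I := neg B (izero B).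

Section LatticeEffectImplicationAlgebra.

Variables (I : Type) (B : imp_ops I).

Local Notation "x ~> y" := (imp B x y) (at level 55, right associativity).
Local Notation "x ^'" := (neg B x) (at level 2, format "x ^'").
Local Notation "0" := (izero B).
Local Notation "1" := (ione B).

Record is_lattice_effect_implication_algebra : Prop := {
  leia_i : forall x, 0 ~> x = 1 /\ x ~> x = 1 /\ x ~> 1 = 1;
  leia_ii : forall x y, x ~> y = 1 -> y ~> x = 1 -> x = y;
  leia_iii : forall x y z, x ~> y = 1 -> y ~> z = 1 -> x ~> z = 1;
  leia_iv : forall x y, x ~> y = 1 -> y^' ~> x^' = 1;
  leia_v : forall x, x^'^' = x;
  leia_vi : forall x y, x ~> ((x ~> y) ~> y) = 1;
  leia_vii : forall x y, y ~> ((x ~> y) ~> y) = 1;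
  leia_viii : forall x y z,
    x ~> z = 1 -> y ~> z = 1 -> ((x ~> y) ~> y) ~> z = 1;
  leia_ix : forall x y, x ~> y = 1 -> y ~> x = x^' ~> y^';
  leia_x_iff : forall x y z,
    (x ~> y^' = 1 /\ (x^' ~> y) ~> z^' = 1) <->
    (y ~> z^' = 1 /\ x ~> (y^' ~> z)^' = 1);
  leia_x_eq : forall x y z,
    x ~> y^' = 1 -> (x^' ~> y) ~> z^' = 1 ->
    (x^' ~> y)^' ~> z = x^' ~> (y^' ~> z);
  leia_xi : forall x y, y^' ~> ((x ~> y) ~> y)^' = x ~> y;
  leia_xii : forall x y, x ~> (y ~> x) = 1
}.

End LatticeEffectImplicationAlgebra.

(* In a lattice effect algebra y <= join x y, so y + (join x y)' is defined
   (see plus_compl_join below) and the None branch is never taken. *)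
Definition IL (E : Type) (A : effect_ops E) : imp_ops E := {|
  imp := fun x y =>
    match plus A y (compl A (join A x y)) with
    | Some z => z
    | None => ezero A
    end;
  izero := ezero A
|}.

Definition EL (I : Type) (B : imp_ops I) : effect_ops I := {|
  plus := fun x y =>
    if excluded_middle_informative (imp B x (neg B y) = ione B)
    then Some (imp B (neg B x) y)
    else None;
  compl := neg B;
  ezero := izero B;
  eone := ione B
|}.

Lemma joinP (E : Type) (A : effect_ops E) (x y : E) :
  is_lattice_effect_algebra A -> is_join (induced_le A) x y (join A x y).
Proof.
intros [_ L]; unfold join; apply epsilon_spec; exact (lattice_order_join L x y).
Qed.

Lemma plus_compl_join (E : Type) (A : effect_ops E) (x y : E) :
  is_lattice_effect_algebra A ->
  exists z, plus A y (compl A (join A x y)) = Some z.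
Proof.
intros LA; destruct (joinP x y LA) as [_ [[z yz] _]].
destruct LA as [EA _].
apply (effect_E1 EA) in yz.
destruct (proj1 (effect_E2 EA z y (compl A (join A x y)) (eone A))) as [v [hv _]].
- exists (join A x y); split; [exact yz | now apply (effect_E3 EA)].
- now exists v.
Qed.

(* Main.v *)
From Stdlib Require Import Relation_Definitions ClassicalEpsilon FunctionalExtensionality.
Require Import Defs.

(** In a lattice effect algebra [x -> y = 1] holds iff [x <= y], and [x + y] is
    defined iff [x <= y'], in which case [x' \/ y = x'] and hence
    [x' -> y = y + x'' = x + y].  Conversely, in a lattice effect implication
    algebra [x <= y] in the induced order iff [x -> y = 1], the witness being
    [x + (y -> x)' = y]; so the join of [x] and [y] is [(x -> y) -> y], and
    axiom (xi) says that [y + ((x -> y) -> y)' = x -> y]. *)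

Section EffectAlgebra.

Variables (E : Type) (A : effect_ops E).
Hypothesis EA : is_effect_algebra A.

Lemma plus_compl x : plus A x (compl A x) = Some (eone A).
Proof. now apply (effect_E3 EA). Qed.

Lemma compl_compl x : compl A (compl A x) = x.
Proof.
symmetry; apply (effect_E3 EA), (effect_E1 EA), plus_compl.
Qed.

Lemma compl_one : compl A (eone A) = ezero A.
Proof. exact (effect_E4 EA (plus_compl (eone A))). Qed.

Lemma compl_zero : compl A (ezero A) = eone A.
Proof. rewrite <- compl_one; apply compl_compl. Qed.

(** Reassociating [(x' + x) + 0 = 1 + 0 = 1] gives [x' + (x + 0) = 1], so (E3) forces
    [x + 0 = x'' = x]. *)
Lemma plus_zero x : plus A x (ezero A) = Some x.
Proof.
destruct (proj1 (effect_E2 EA (compl A x) x (ezero A) (eone A)))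
  as [v [xv v1]].
- exists (eone A); split.
  + apply (effect_E1 EA), plus_compl.
  + apply (effect_E3 EA); now rewrite compl_one.
- apply (effect_E3 EA) in v1; rewrite compl_compl in v1; now subst v.
Qed.

Lemma zero_le x : induced_le A (ezero A) x.
Proof. exists x; apply (effect_E1 EA), plus_zero. Qed.

(** Both directions reassociate a sum equal to 1: [(y + x) + s' = 1] yields [x + s' = y'], and
    [x + z = y'] yields [(z + x) + y = 1], whence [x + y] exists. *)
Lemma plus_defined_iff x y :
  (exists s, plus A x y = Some s) <-> induced_le A x (compl A y).
Proof.
split.
- intros [s xy].
  destruct (proj1 (effect_E2 EA y x (compl A s) (eone A))) as [v [xv yv]].
  + exists s; split; [now apply (effect_E1 EA) | apply plus_compl].
  + apply (effect_E3 EA) in yv; subst v; now exists (compl A s).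
- intros [z xz].
  destruct (proj1 (effect_E2 EA z x y (eone A))) as [v [xy _]].
  + exists (compl A y); split; [now apply (effect_E1 EA) |].
    apply (effect_E1 EA), plus_compl.
  + now exists v.
Qed.

Lemma le_compl_sym x y :
  induced_le A x (compl A y) -> induced_le A y (compl A x).
Proof.
intros xy; apply plus_defined_iff in xy; destruct xy as [s xy].
apply plus_defined_iff; exists s; now apply (effect_E1 EA).
Qed.

End EffectAlgebra.

(** Identifies the join chosen by epsilon with an explicitly known one, in both halves of the
    theorem. *)
Lemma is_join_unique (T : Type) (le : relation T) (x y j k : T) :
  (forall a b, le a b -> le b a -> a = b) ->
  is_join le x y j -> is_join le x y k -> j = k.
Proof. intros anti [xj [yj lj]] [xk [yk lk]]; auto. Qed.

Section LatticeEffectAlgebra.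

Variables (E : Type) (A : effect_ops E).
Hypothesis LA : is_lattice_effect_algebra A.

Let EA : is_effect_algebra A := lattice_effect_effect LA.
Let ord : order E (induced_le A) :=
  lattice_order_order (lattice_effect_lattice LA).

Lemma join_absorb_l x y : induced_le A y x -> join A x y = x.
Proof.
intros yx; apply (is_join_unique _ (induced_le A) x y).
- exact (ord_antisym _ _ ord).
- now apply joinP.
- repeat split; auto; apply (ord_refl _ _ ord).
Qed.

Lemma join_absorb_r x y : induced_le A x y -> join A x y = y.
Proof.
intros xy; apply (is_join_unique _ (induced_le A) x y).
- exact (ord_antisym _ _ ord).
- now apply joinP.
- repeat split; auto; apply (ord_refl _ _ ord).
Qed.

Lemma imp_IL x y :
  plus A y (compl A (join A x y)) = Some (imp (IL A) x y).
Proof. destruct (plus_compl_join x y LA) as [z yz]; simpl; now rewrite yz. Qed.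

Lemma neg_IL x : neg (IL A) x = compl A x.
Proof.
assert (h := imp_IL x (ezero A)).
rewrite (join_absorb_l _ _ (zero_le _ _ EA x)) in h.
rewrite (effect_E1 EA (plus_zero _ _ EA _)) in h.
now injection h.
Qed.

Lemma ione_IL : ione (IL A) = eone A.
Proof. unfold ione; rewrite neg_IL; now apply compl_zero. Qed.

Lemma imp_IL_one_iff x y : imp (IL A) x y = ione (IL A) <-> induced_le A x y.
Proof.
assert (h := imp_IL x y); rewrite ione_IL; split; intros xy.
(* From [y + (x \/ y)' = 1], (E3) gives [(x \/ y)' = y'], so [y] is the join itself and lies above
   [x]. *)
- rewrite xy in h; apply (effect_E3 EA) in h.
  rewrite <- (compl_compl _ _ EA y), <- h, (compl_compl _ _ EA).
  now apply joinP.
- rewrite (join_absorb_r _ _ xy), (plus_compl _ _ EA) in h; now injection h.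
Qed.

Lemma plus_EL_IL x y : plus (EL (IL A)) x y = plus A x y.
Proof.
cbn [EL plus]; rewrite !neg_IL.
destruct (excluded_middle_informative _) as [xy | xy];
  rewrite imp_IL_one_iff in xy.
- rewrite <- imp_IL, (join_absorb_l _ _ (le_compl_sym _ _ EA _ _ xy)).
  rewrite (compl_compl _ _ EA).
  apply (plus_defined_iff _ _ EA) in xy; destruct xy as [s xy].
  rewrite xy; now apply (effect_E1 EA).
- destruct (plus A x y) as [s |] eqn:e; [| reflexivity].
  destruct xy; apply (plus_defined_iff _ _ EA); now exists s.
Qed.

Lemma EL_IL : EL (IL A) = A.
Proof.
assert (hp : plus (EL (IL A)) = plus A)
  by (extensionality x; extensionality y; apply plus_EL_IL).
assert (hc : compl (EL (IL A)) = compl A)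
  by (extensionality x; apply neg_IL).
assert (h1 : eone (EL (IL A)) = eone A) by apply ione_IL.
assert (h0 : ezero (EL (IL A)) = ezero A) by reflexivity.
(* With [EL (IL A)] replaced by an arbitrary record, equality of the fields gives equality of the
   structures. *)
revert hp hc h0 h1; generalize (EL (IL A)).
intros [p c z o]; destruct A; simpl; now intros -> -> -> ->.
Qed.

End LatticeEffectAlgebra.

Section ImplicationAlgebra.

Variables (I : Type) (B : imp_ops I).
Hypothesis LB : is_lattice_effect_implication_algebra B.

Lemma plus_EL x y s :
  plus (EL B) x y = Some s <->
  imp B x (neg B y) = ione B /\ imp B (neg B x) y = s.
Proof.
simpl; destruct (excluded_middle_informative _) as [xy | xy]; split.
- intros h; injection h; auto.
- now intros [_ ->].
- discriminate.
- now intros [h _].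
Qed.

(** By (vi) and (viii) the left side is above [y] and below every common upper bound of [y] and [x],
    such as [y]. *)
Lemma imp_imp_of_le x y : imp B x y = ione B -> imp B (imp B y x) x = y.
Proof.
intros xy; apply (leia_ii LB).
- apply (leia_viii LB); [apply (leia_i LB) | exact xy].
- apply (leia_vi LB).
Qed.

Lemma induced_le_EL x y : induced_le (EL B) x y <-> imp B x y = ione B.
Proof.
split.
- intros [z h]; apply plus_EL in h; destruct h as [xz <-].
  (* By (ix) applied to [x] and [z'], the sum [x' -> z''] is [z' -> x], which is above [x] by
     (xii). *)
  rewrite <- (leia_v LB z), <- (leia_ix LB xz).
  apply (leia_xii LB).
- intros xy; exists (neg B (imp B y x)); apply plus_EL.
  rewrite (leia_v LB); split; [apply (leia_xii LB) |].
  (* Since [x -> (y -> x) = 1], (ix) turns [x' -> (y -> x)'] into [(y -> x) -> x]. *)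
  rewrite <- (leia_ix LB (leia_xii LB x y)).
  now apply imp_imp_of_le.
Qed.

Lemma join_EL x y : join (EL B) x y = imp B (imp B x y) y.
Proof.
assert (H : is_join (induced_le (EL B)) x y (imp B (imp B x y) y)).
{ split; [| split]; [| | intros z]; rewrite !induced_le_EL.
  - apply (leia_vi LB).
  - apply (leia_vii LB).
  - apply (leia_viii LB). }
apply (is_join_unique _ (induced_le (EL B)) x y).
- intros a b; rewrite !induced_le_EL; apply (leia_ii LB).
(* The epsilon choice is a genuine join because [H] exhibits one. *)
- unfold join; apply epsilon_spec; eexists; exact H.
- exact H.
Qed.

Lemma imp_IL_EL x y : imp (IL (EL B)) x y = imp B x y.
Proof.
cbn [IL imp].
replace (plus (EL B) y _) with (Some (imp B x y)); [reflexivity |].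
(* The sum is defined by (v) and (vii), and its value is given by (xi). *)
symmetry; apply plus_EL; rewrite join_EL; simpl; split.
- rewrite (leia_v LB); apply (leia_vii LB).
- apply (leia_xi LB).
Qed.

Lemma IL_EL : IL (EL B) = B.
Proof.
assert (hi : imp (IL (EL B)) = imp B)
  by (extensionality x; extensionality y; apply imp_IL_EL).
assert (h0 : izero (IL (EL B)) = izero B) by reflexivity.
revert hi h0; generalize (IL (EL B)).
intros [i z]; destruct B; simpl; now intros -> ->.
Qed.

End ImplicationAlgebra.

Theorem theorem2p6 :
  (forall (E : Type) (A : effect_ops E),
      is_lattice_effect_algebra A -> EL (IL A) = A) /\
  (forall (I : Type) (B : imp_ops I),
      is_lattice_effect_implication_algebra B -> IL (EL B) = B).
Proof. split; [exact EL_IL | exact IL_EL]. Qed.
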